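(* For every $h\in\omega^\omega$ with $\limsup_n h(n)=\infty$, $f\mathcal{S}(h)\perp\mathcal{M}_-$, i.e. there are $A\in f\mathcal{S}(h)$ and $B\in\mathcal{M}_-$ with $A\cup B=\omega^\omega$.
   Context: $\exists^\infty n$ means ''for infinitely many $n\in\omega$'', $\forall^\infty n$ means ''for all but finitely many $n\in\omega$''. For $h\in\omega^\omega$ with $\limsup_n h(n)=\infty$, a set $F\subseteq\omega^\omega$ belongs to $f\mathcal{S}(h)$ if there are a partition $(I_n)_{n\in\omega}$ of $\omega$ into (nonempty, finite) intervals and a sequence $(J_n)_{n\in\omega}$ with $J_n\subseteq\omega^{I_n}$ and $\sum_{n\in\omega}\frac{|J_n|}{h(|I_n|)}<\infty$ such that $F\subseteq\{x\in\omega^\omega:(\exists^\infty n)(x\upharpoonright I_n\in J_n)\}$. Convention: $k/0=\infty$ for $k>0$ and $0/0=0$. A set $F\subseteq\omega^\omega$ belongs to $\mathcal{M}_-$ if there are $x_F\in\omega^\omega$ and a partition $(I_n)_{n\in\omega}$ of $\omega$ into (nonempty, finite) intervals such that $F\subseteq\{x\in\omega^\omega:(\forall^\infty n)(x\upharpoonright I_n\neq x_F\upharpoonright I_n)\}$. Families $\mathcal{I},\mathcal{J}$ of subsets of $\omega^\omega$ are orthogonal, $\mathcal{I}\perp\mathcal{J}$, if there are $A\in\mathcal{I}$, $B\in\mathcal{J}$ with $A\cup B=\omega^\omega$. *)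

(* Defs.v *)
From HB Require Import structures.
From mathcomp Require Import all_boot all_order all_algebra.
From mathcomp Require Import finmap.
From mathcomp Require Import all_classical all_reals all_analysis.

Set Implicit Arguments.
Unset Strict Implicit.
Unset Printing Implicit Defensive.

Import Order.TTheory GRing.Theory Num.Theory.

Local Open Scope classical_set_scope.
Local Open Scope ring_scope.

Definition exists_inf (P : nat -> Prop) : Prop := infinite_set [set n | P n].

Definition forall_inf (P : nat -> Prop) : Prop := finite_set [set n | ~ P n].

Definition nat_interval (A : set nat) : Prop :=
  forall i j k : nat, A i -> A k -> (i <= j <= k)%N -> A j.

(* The enumeration of the blocks is not required to be increasing: the notions
   below are invariant under permuting the index n.  Nonemptiness of the blocks
   is part of [partition]. *)
Definition interval_partition (I : nat -> set nat) : Prop :=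
  [/\ partition setT I setT,
      forall n, nat_interval (I n) &
      forall n, finite_set (I n)].

(* [sigL A x : A -> nat] is the restriction of x to A, so a subset of omega^A
   is a [set (A -> nat)].  [counting] is the cardinality, +oo on infinite sets.
   Division is that of \bar R, where 0^-1 = +oo and 0 * +oo = 0; hence k / 0
   is +oo for k > 0 and 0 / 0 = 0. *)
Definition fS (R : realType) (h : nat -> nat) : set (set (nat -> nat)) :=
  [set F | exists (I : nat -> set nat) (J : forall n, set (I n -> nat)),
    [/\ interval_partition I,
        (\sum_(0 <= n <oo)
           counting (J n) / (h #|` fset_set (I n)|)%:R%:E < +oo :> \bar R)%E &
        F `<=` [set x | exists_inf (fun n => J n (sigL (I n) x))]]].

Definition M_minus : set (set (nat -> nat)) :=
  [set F | exists (xF : nat -> nat) (I : nat -> set nat),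
    interval_partition I /\
    F `<=` [set x | forall_inf (fun n => sigL (I n) x <> sigL (I n) xF)]].

Definition orthogonal_families (T : Type) (I J : set (set T)) : Prop :=
  exists A B : set T, [/\ I A, J B & A `|` B = setT].

(* Main.v *)
Require Import Defs.
From mathcomp Require Import all_boot all_order all_algebra.
From mathcomp Require Import all_classical all_reals all_analysis.

Import Order.TTheory GRing.Theory Num.Theory.

Local Open Scope ring_scope.
Local Open Scope classical_set_scope.

(** The two ideals are separated by a single point, the zero sequence.  Fix an
    interval partition [I], let [J n] consist of the zero block on [I n] alone,
    and put [A := {x | x vanishes on infinitely many I n}].  The complement of
    [A] consists of the sequences that differ from the zero sequence on all but
    finitely many [I n], so it belongs to [M_minus] whatever [I] is.  For [A] to
    belong to [fS R h], the series of the [1 / h (|I n|)] has to converge.  As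
    [h] has infinite limit superior, there are positive lengths [l n] with
    [2 ^ n.+1 <= h (l n)] ([limn_esup_nat_unbounded]); cutting [nat] into
    consecutive intervals of these lengths ([interval_partition_blocks]) makes
    the series at most geometric. *)

(** Only the values at positive arguments matter for block lengths: discarding
    the argument 0 does not change the limit superior, so a bound on the
    remaining values would bound it too. *)
Lemma limn_esup_nat_unbounded {R : realType} (h : nat -> nat) (M : nat) :
  limn_esup (fun n => (h n)%:R%:E : \bar R) = +oo%E ->
  exists2 n, (0 < n)%N & (M <= h n)%N.
Proof.
move=> hoo; apply: contrapT => hM.
suff: (limn_esup (fun n => (h n)%:R%:E : \bar R) <= M%:R%:E)%E.
  by rewrite hoo leye_eq.
apply: (@le_trans _ _ (esups (fun n => (h n)%:R%:E : \bar R) 1%N)).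
  rewrite limn_esup_lim; apply: lime_le; first exact: is_cvg_esups.
  by exists 1%N => // n /= n1; exact: nonincreasing_esups.
apply: ge_ereal_sup => _ [n /= n0 <-]; rewrite lee_fin ler_nat leqNgt.
by apply/negP => Mh; apply: hM; exists n => //; exact: ltnW.
Qed.

Definition block_start (l : nat -> nat) (n : nat) : nat := (\sum_(i < n) l i)%N.

Definition block (l : nat -> nat) (n : nat) : set nat :=
  `I_(block_start l n.+1) `\` `I_(block_start l n).

Lemma blockE (l : nat -> nat) (n k : nat) :
  block l n k <-> (block_start l n <= k < block_start l n.+1)%N.
Proof.
rewrite /block /=; split => [[-> /negP]|/andP[sk ->]].
  by rewrite -leqNgt => ->.
by split => //; apply/negP; rewrite -leqNgt.
Qed.

Lemma block_start_le (l : nat -> nat) (m n : nat) :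
  (m <= n)%N -> (block_start l m <= block_start l n)%N.
Proof.
apply: (homo_leq leqnn leq_trans) => i.
by rewrite /block_start big_ord_recr leq_addr.
Qed.

Lemma leq_block_start (l : nat -> nat) (n : nat) :
  (forall i, 0 < l i)%N -> (n <= block_start l n)%N.
Proof.
by move=> l0; rewrite -[leqLHS]card_ord -sum1_card; apply: leq_sum.
Qed.

Lemma card_block (l : nat -> nat) (n : nat) :
  size (finmap.enum_fset (fset_set (block l n))) = l n.
Proof.
apply: card_fset_set; apply: card_eq_trans card_IID _.
by rewrite /block_start big_ord_recr /= addKn.
Qed.

(** Positive lengths make the partial sums exceed every [k], so the least [n]
    with [k < block_start l n.+1] exists; it is the index of the block
    containing [k]. *)
Lemma interval_partition_blocks (l : nat -> nat) :
  (forall i, 0 < l i)%N -> interval_partition (block l).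
Proof.
move=> l0; split; first last.
- by move=> n; apply: finite_setD; exact: finite_II.
- move=> n i j k /blockE /andP[si _] /blockE /andP[_ ks] /andP[ij jk].
  by apply/blockE; rewrite (leq_trans si ij) (leq_ltn_trans jk ks).
split.
- apply/seteqP; split => // k _.
  have ex : exists n, (k < block_start l n.+1)%N.
    by exists k; exact: leq_block_start.
  case: (ex_minnP ex) => n kn nmin; exists n => //; apply/blockE.
  rewrite kn andbT leqNgt; apply/negP.
  case: n nmin {kn} => [|n] nmin; first by rewrite /block_start big_ord0.
  by move/nmin; rewrite ltnn.
- move=> m n _ _ [k [/blockE/andP[sm km] /blockE/andP[sn kn]]].
  have disj i j : (block_start l i <= k)%N -> (k < block_start l j.+1)%N ->
      (i <= j)%N.
    move=> si kj; rewrite leqNgt; apply/negP => /(block_start_le l).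
    by move=> /leq_trans/(_ si); rewrite leqNgt kj.
  by apply/eqP; rewrite eqn_leq; apply/andP; split; exact: disj.
- move=> n _; exists (block_start l n); apply/blockE.
  by rewrite leqnn /block_start big_ord_recr -[ltnLHS]addn0 ltn_add2l l0.
Qed.

Lemma counting_set1 {T : choiceType} {R : realType} (x : T) :
  counting [set x] = 1%E :> \bar R.
Proof.
by rewrite /counting asboolT; [rewrite fset_set1 finmap.cardfs1|exact: finite_set1].
Qed.

Lemma nneseries_inv_lty {R : realType} (a : nat -> nat) :
  (forall n, 2 ^ n.+1 <= a n)%N ->
  (\sum_(0 <= n <oo) 1 / (a n)%:R%:E < +oo :> \bar R)%E.
Proof.
move=> ha.
have a0 n : 0 < (a n)%:R :> R.
  by rewrite ltr0n (leq_trans _ (ha n)) // expn_gt0.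
have aE n : (1 / (a n)%:R%:E = (1 / (a n)%:R)%:E :> \bar R)%E.
  by rewrite inver (gt_eqF (a0 n)) -EFinM.
have le_geo : (\sum_(0 <= n <oo) 1 / (a n)%:R%:E <=
    \sum_(0 <= n <oo) (1 / (2 ^ (n + 1))%:R)%:E :> \bar R)%E.
  apply: lee_nneseries => n *; rewrite aE lee_fin.
    by rewrite divr_ge0 // ltW.
  by rewrite !div1r lef_pV2 ?posrE ?a0 ?ltr0n ?expn_gt0 // ler_nat addn1.
apply: le_lt_trans le_geo _.
by rewrite (cvg_lim _ (@cvg_geometric_eseries_half R 1 0)) // ltry.
Qed.

Theorem theorem40 (R : realType) (h : nat -> nat)
    (hlimsup : limn_esup (fun n => (h n)%:R%:E : \bar R) = +oo%E) :
  orthogonal_families (fS R h) M_minus.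
Proof.
have /choice[l lP] n : exists k, ((0 < k) && (2 ^ n.+1 <= h k))%N.
  have [k k0 hk] := limn_esup_nat_unbounded h (2 ^ n.+1)%N hlimsup.
  by exists k; rewrite k0.
have l0 n : (0 < l n)%N by have /andP[] := lP n.
have lh n : (2 ^ n.+1 <= h (l n))%N by have /andP[] := lP n.
pose z : nat -> nat := fun=> 0%N.
pose A := [set x | exists_inf (fun n => sigL (block l n) x = sigL (block l n) z)].
have Ipart := interval_partition_blocks l l0.
exists A, (~` A); split; last exact: setUv.
- exists (block l), (fun n => [set sigL (block l n) z]); split => //.
  under eq_eseriesr do rewrite counting_set1 card_block.
  exact: nneseries_inv_lty.
- exists z, (block l); split => // x /contrapT.
  rewrite /forall_inf /=; apply: sub_finite_set => n /=.
  exact: contrapT.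
Qed.
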